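(* Let $(A,T)$ be a Rota-Baxter algebra of weight $\lambda$, $(M,T_M)$ a Rota-Baxter bimodule over it, and let $\psi:A\otimes A\to M$ and $\chi:A\to M$ be linear maps. Define on $A\oplus M$ $$(a,m)\cdot_\psi(b,n)=(ab,\;an+mb+\psi(a\otimes b)),\qquad T_\chi(a,m)=(T(a),\;\chi(a)+T_M(m)).$$ Then $(A\oplus M,\cdot_\psi,T_\chi)$ is a Rota-Baxter algebra of weight $\lambda$ if and only if $(\psi,\chi)$ is a $2$-cocycle of the Rota-Baxter algebra $(A,T)$ with coefficients in $(M,T_M)$, i.e. a $2$-cocycle of $\mathrm{C}^\bullet_{\mathrm{RBA}_\lambda}(A,M)$. In this case, $0\to(M,T_M)\to(A\oplus M,T_\chi)\to(A,T)\to0$, with maps $m\mapsto(0,m)$ and $(a,m)\mapsto a$, is an abelian extension, and the canonical section $s:A\to A\oplus M$, $a\mapsto(a,0)$, endows $M$ with the original Rota-Baxter bimodule structure.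
   Context: $\mathbf{k}$ is a field of characteristic $0$, $\lambda\in\mathbf{k}$; everything is over $\mathbf{k}$. A Rota-Baxter algebra of weight $\lambda$ is an associative algebra $A$ with a linear map $T:A\to A$ such that $T(a)T(b)=T(aT(b)+T(a)b+\lambda ab)$. A Rota-Baxter bimodule over $(A,T)$ is an $A$-bimodule $M$ with a linear map $T_M:M\to M$ such that $T(a)T_M(m)=T_M(aT_M(m)+T(a)m+\lambda am)$ and $T_M(m)T(a)=T_M(mT(a)+T_M(m)a+\lambda ma)$. Write $a_{i,j}=a_i\otimes\cdots\otimes a_j$ (empty if $i>j$). **Abelian extensions.** View $(M,T_M)$ as a Rota-Baxter algebra with zero multiplication. An abelian extension of $(A,T)$ by $(M,T_M)$ is a short exact sequence of morphisms of Rota-Baxter algebras $0\to(M,T_M)\xrightarrow{i}(\hat A,\hat T)\xrightarrow{p}(A,T)\to0$; $M$ is identified with $i(M)$. A section is a linear map $s:A\to\hat A$ with $p\circ s=\mathrm{Id}_A$; it endows $(M,T_M)$ with the Rota-Baxter bimodule structure $am:=s(a)m$, $ma:=ms(a)$. **Cochain complex.** Let $\mathrm{C}^n_{\mathrm{Alg}}(A,M)=\mathrm{C}^n_{\mathrm{RBO}_\lambda}(A,M)=\mathrm{Hom}(A^{\otimes n},M)$, $n\geqslant0$. - $\delta^n(f)(a_{1,n+1})=(-1)^{n+1}a_1f(a_{2,n+1})+\sum_{i=1}^n(-1)^{n-i+1}f(a_{1,i-1}\otimes a_ia_{i+1}\otimes a_{i+2,n+1})+f(a_{1,n})a_{n+1}$.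 - With $a\star b=aT(b)+T(a)b+\lambda ab$, $a\rhd m=T(a)m-T_M(am)$, $m\lhd a=mT(a)-T_M(ma)$: $\partial^n(f)(a_{1,n+1})=(-1)^{n+1}a_1\rhd f(a_{2,n+1})+\sum_{i=1}^n(-1)^{n-i+1}f(a_{1,i-1}\otimes a_i\star a_{i+1}\otimes a_{i+2,n+1})+f(a_{1,n})\lhd a_{n+1}$. - $\Phi^0=\mathrm{Id}$ and for $n\geqslant1$: $\Phi^n(f)(a_{1,n})=f(T(a_1)\otimes\cdots\otimes T(a_n))-\sum_{k=0}^{n-1}\lambda^{n-k-1}\sum_{1\leqslant i_1<\cdots<i_k\leqslant n}T_M\circ f(a_{1,i_1-1}\otimes T(a_{i_1})\otimes a_{i_1+1,i_2-1}\otimes T(a_{i_2})\otimes\cdots\otimes T(a_{i_k})\otimes a_{i_k+1,n})$. - $\mathrm{C}^0_{\mathrm{RBA}_\lambda}(A,M)=\mathrm{C}^0_{\mathrm{Alg}}(A,M)$, $\mathrm{C}^n_{\mathrm{RBA}_\lambda}(A,M)=\mathrm{C}^n_{\mathrm{Alg}}(A,M)\oplus\mathrm{C}^{n-1}_{\mathrm{RBO}_\lambda}(A,M)$ for $n\geqslant1$, with $d^n(f,g)=(\delta^n(f),-\partial^{n-1}(g)-\Phi^n(f))$. *)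

(* Defs.v *)
From mathcomp Require Import all_boot all_algebra.

Set Implicit Arguments.
Unset Strict Implicit.
Unset Printing Implicit Defensive.

Import GRing.Theory.
Local Open Scope ring_scope.

(* Algebras are associative but not assumed to be unital (a module with zero  *)
(* multiplication has to be an algebra), so the multiplication is an explicit *)
(* operation on a left k-module rather than a MathComp ring structure.        *)

Section RotaBaxter.

Variables (k : fieldType) (lambda : k).

Record is_rb_algebra (A : lmodType k) (mul : A -> A -> A) (T : A -> A) : Prop := {
  rb_mul_bilinear : bilinear_for *:%R *:%R mul;
  rb_mulA : forall a b c, mul a (mul b c) = mul (mul a b) c;
  rb_linear : linear T;
  rb_identity : forall a b,
    mul (T a) (T b) = T (mul a (T b) + mul (T a) b + lambda *: mul a b)
}.

(* [l a m] is the left action a m, [r m a] the right action m a. *)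
Record is_rb_bimodule (A : lmodType k) (mul : A -> A -> A) (T : A -> A)
    (M : lmodType k) (l : A -> M -> M) (r : M -> A -> M) (TM : M -> M)
    : Prop := {
  rbm_l_bilinear : bilinear_for *:%R *:%R l;
  rbm_r_bilinear : bilinear_for *:%R *:%R r;
  rbm_lA : forall a b m, l a (l b m) = l (mul a b) m;
  rbm_rA : forall m a b, r (r m a) b = r m (mul a b);
  rbm_lrA : forall a m b, r (l a m) b = l a (r m b);
  rbm_linear : linear TM;
  rbm_l_identity : forall a m,
    l (T a) (TM m) = TM (l a (TM m) + l (T a) m + lambda *: l a m);
  rbm_r_identity : forall m a,
    r (TM m) (T a) = TM (r m (T a) + r (TM m) a + lambda *: r m a)
}.

Record is_rb_morphism (A B : lmodType k)
    (mulA : A -> A -> A) (TA : A -> A) (mulB : B -> B -> B) (TB : B -> B)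
    (f : A -> B) : Prop := {
  rb_morph_linear : linear f;
  rb_morphM : forall a b, f (mulA a b) = mulB (f a) (f b);
  rb_morphT : forall a, f (TA a) = TB (f a)
}.

Definition zero_mul (M : lmodType k) (m n : M) : M := 0.

Record is_abelian_extension (A : lmodType k) (mul : A -> A -> A) (T : A -> A)
    (M : lmodType k) (TM : M -> M)
    (E : lmodType k) (mulE : E -> E -> E) (TE : E -> E)
    (i : M -> E) (p : E -> A) : Prop := {
  ext_sub : is_rb_algebra (@zero_mul M) TM;
  ext_mid : is_rb_algebra mulE TE;
  ext_quo : is_rb_algebra mul T;
  ext_i : is_rb_morphism (@zero_mul M) TM mulE TE i;
  ext_p : is_rb_morphism mulE TE mul T p;
  ext_i_inj : injective i;
  ext_exact : forall e : E, p e = 0 <-> exists m : M, i m = e;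
  ext_p_surj : forall a : A, exists e : E, p e = a
}.

Record is_section (A E : lmodType k) (p : E -> A) (s : A -> E) : Prop := {
  section_linear : linear s;
  section_can : cancel s p
}.

(* The actions that [s] induces on M = i(M) are [l] and [r]; since [i] is     *)
(* injective, the two equations determine [l] and [r].                        *)
Definition section_induces (A M E : lmodType k) (mulE : E -> E -> E)
    (i : M -> E) (s : A -> E) (l : A -> M -> M) (r : M -> A -> M) : Prop :=
  (forall a m, i (l a m) = mulE (s a) (i m)) /\
  (forall m a, i (r m a) = mulE (i m) (s a)).

End RotaBaxter.

Section Cochains.

Variables (k : fieldType) (A M : lmodType k).

(* Hom(A^{(x) n}, M) is represented by the multilinear maps in n variables:   *)
(* functions on finite families satisfying [multilinear].                     *)
Definition multi (n : nat) : Type := {ffun 'I_n -> A} -> M.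

Definition multilinear (n : nat) (f : multi n) : Prop :=
  forall (i : 'I_n) (v : {ffun 'I_n -> A}),
    linear (fun x : A => f [ffun j => if j == i then x else v j]).

Definition multi1 (f : A -> M) : multi 1 := fun v => f (v ord0).
Definition multi2 (f : A -> A -> M) : multi 2 := fun v => f (v ord0) (v ord_max).

Definition all_but_first (n : nat) (v : {ffun 'I_n.+1 -> A}) : {ffun 'I_n -> A} :=
  [ffun j => v (lift ord0 j)].

Definition all_but_last (n : nat) (v : {ffun 'I_n.+1 -> A}) : {ffun 'I_n -> A} :=
  [ffun j => v (lift ord_max j)].

(* Replaces the consecutive entries of (0-based) indices i, i+1 by their      *)
(* product; [lift ord_max j] has value j and [lift ord0 j] has value j + 1.   *)
Definition contract (mul : A -> A -> A) (n : nat) (v : {ffun 'I_n.+1 -> A})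
    (i : 'I_n) : {ffun 'I_n -> A} :=
  [ffun j : 'I_n =>
     if (j < i)%N then v (lift ord_max j)
     else if j == i then mul (v (lift ord_max i)) (v (lift ord0 i))
     else v (lift ord0 j)].

(* The common shape of delta and partial. The middle index i : 'I_n is        *)
(* 0-based, so the sign (-1)^(n-i+1) for 1-based i becomes (-1)^(n-i).        *)
Definition hochschild (mul : A -> A -> A) (l : A -> M -> M) (r : M -> A -> M)
    (n : nat) (f : multi n) : multi n.+1 := fun v =>
  (-1) ^+ n.+1 *: l (v ord0) (f (all_but_first v))
  + \sum_(i < n) (-1) ^+ (n - i) *: f (contract mul v i)
  + r (f (all_but_last v)) (v ord_max).

End Cochains.

Section Complex.

Variables (k : fieldType) (lambda : k) (A M : lmodType k).
Variables (mul : A -> A -> A) (T : A -> A).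
Variables (l : A -> M -> M) (r : M -> A -> M) (TM : M -> M).

Definition star (a b : A) : A := mul a (T b) + mul (T a) b + lambda *: mul a b.
Definition lstar (a : A) (m : M) : M := l (T a) m - TM (l a m).
Definition rstar (m : M) (a : A) : M := r m (T a) - TM (r m a).

Definition delta (n : nat) : multi A M n -> multi A M n.+1 :=
  @hochschild k A M mul l r n.

Definition partial (n : nat) : multi A M n -> multi A M n.+1 :=
  @hochschild k A M star lstar rstar n.

(* Increasing sequences i_1 < ... < i_k are subsets of 'I_n of cardinal k.    *)
Definition apply_on (n : nat) (I : {set 'I_n}) (v : {ffun 'I_n -> A}) :
    {ffun 'I_n -> A} :=
  [ffun j => if j \in I then T (v j) else v j].

Definition Phi (n : nat) (f : multi A M n) : multi A M n := fun v =>
  if n == 0%N then f v else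
  f [ffun j => T (v j)]
  - \sum_(q < n) lambda ^+ (n - q - 1) *:
      \sum_(I : {set 'I_n} | #|I| == q) TM (f (apply_on I v)).

Definition rba_cochain (n : nat) : Type :=
  if n is n'.+1 then (multi A M n'.+1 * multi A M n')%type else multi A M 0.

Definition is_rba_cochain (n : nat) : rba_cochain n -> Prop :=
  match n with
  | 0 => fun f => multilinear f
  | n'.+1 => fun c => multilinear c.1 /\ multilinear c.2
  end.

Definition rba_diff (n : nat) : rba_cochain n -> rba_cochain n.+1 :=
  match n with
  | 0 => fun f => (delta f, fun v => - Phi f v)
  | n'.+1 => fun c => (delta c.1, fun v => - partial c.2 v - Phi c.1 v)
  end.

Definition is_rba_zero (n : nat) : rba_cochain n -> Prop :=
  match n with
  | 0 => fun f => forall v, f v = 0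
  | n'.+1 => fun c => (forall v, c.1 v = 0) /\ (forall v, c.2 v = 0)
  end.

Definition is_rba_cocycle (n : nat) (c : rba_cochain n) : Prop :=
  is_rba_cochain c /\ is_rba_zero (rba_diff c).

End Complex.

Section Extension.

Variables (k : fieldType) (A M : lmodType k).
Variables (mul : A -> A -> A) (T : A -> A).
Variables (l : A -> M -> M) (r : M -> A -> M) (TM : M -> M).
Variables (psi : A -> A -> M) (chi : A -> M).

Definition ext_mul (x y : A * M) : A * M :=
  (mul x.1 y.1, l x.1 y.2 + r x.2 y.1 + psi x.1 y.1).

Definition ext_op (x : A * M) : A * M := (T x.1, chi x.1 + TM x.2).

Definition ext_incl (m : M) : A * M := (0, m).
Definition ext_proj (x : A * M) : A := x.1.
Definition ext_section (a : A) : A * M := (a, 0).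

End Extension.

(* Main.v *)
Require Import Defs.
From HB Require Import structures.
From mathcomp Require Import all_boot all_algebra.
Local Open Scope ring_scope.
Import GRing.Theory.

Set Implicit Arguments.
Unset Strict Implicit.
Unset Printing Implicit Defensive.

(** The two structure equations of A (+) M can fail only in the M component,
since their A components hold in A. The failure itself is a value of the
differential:
- the associator of (a, m), (b, n), (c, p) is (0, delta psi (a, b, c)),
  because every term that contains m, n or p cancels by the bimodule axioms
  ([ext_mul_associator]);
- the difference of the two sides of the Rota-Baxter identity at (a, m) and
  (b, n) is (0, (partial chi + Phi psi) (a, b)), because the terms in m and n
  cancel by the two Rota-Baxter identities of M ([ext_rb_defect]).
Bilinearity of the product and linearity of the operator hold for any psi and
chi. So A (+) M is a Rota-Baxter algebra exactly when both values vanish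
([is_rb_algebra_extP]), and this is the 2-cocycle condition once the
alternating sum and the sum over subsets are written out in degree 2
([is_rba_cocycle2P]).

The extension is then checked directly: every cross term that psi or chi could
add is evaluated at 0. *)

Section LowDegree.

Variables (k : fieldType) (lambda : k) (A M : lmodType k).

Definition ffun2 (a b : A) : {ffun 'I_2 -> A} := [ffun i => tnth [tuple a; b] i].

Definition ffun3 (a b c : A) : {ffun 'I_3 -> A} :=
  [ffun i => tnth [tuple a; b; c] i].

(** Lets the families indexed by ordinals in the definition of a cocycle be
replaced by explicit lists of arguments. *)
Lemma ffun2_eta (v : {ffun 'I_2 -> A}) : v = ffun2 (v ord0) (v ord_max).
Proof.
apply/ffunP=> i; rewrite ffunE (tnth_nth 0).
by case: i => [[|[|i]] lt_i2] //=; congr (v _); apply: val_inj.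
Qed.

Lemma ffun3_eta (v : {ffun 'I_3 -> A}) :
  v = ffun3 (v ord0) (v (lift ord0 ord0)) (v ord_max).
Proof.
apply/ffunP=> i; rewrite ffunE (tnth_nth 0).
by case: i => [[|[|[|i]]] lt_i3] //=; congr (v _); apply: val_inj.
Qed.

Lemma multilinear_multi1 (f : {linear A -> M}) : multilinear (multi1 f).
Proof. by move=> i v c x y; rewrite /multi1 !ffunE (ord1 i) /= linearP. Qed.

Lemma multilinear_multi2 (f : {bilinear A -> A -> M}) :
  multilinear (multi2 f).
Proof.
move=> i v c x y; rewrite /multi2 !ffunE.
by case: i => [[|[|i]] lt_i2] //=; rewrite -?val_eqE /= ?linearPl ?linearPr.
Qed.

Variables (mul : A -> A -> A) (l : A -> M -> M) (r : M -> A -> M).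

(** Stated for arbitrary products and actions, as [partial] is this differential
for the star product and the modified actions. *)
Lemma hochschild_multi1 (f : A -> M) (a b : A) :
  hochschild mul l r (multi1 f) (ffun2 a b)
  = l a (f b) - f (mul a b) + r (f a) b.
Proof.
rewrite /hochschild big_ord1 /multi1 !ffunE /= !(tnth_nth 0) /=.
by rewrite sqrrN expr1n !scale1r expr1 scaleN1r.
Qed.

Lemma hochschild_multi2 (f : A -> A -> M) (a b c : A) :
  hochschild mul l r (multi2 f) (ffun3 a b c)
  = - l a (f b c) + (f (mul a b) c - f a (mul b c)) + r (f a b) c.
Proof.
rewrite /hochschild big_ord_recl big_ord1 /multi2 !ffunE /= !(tnth_nth 0) /=.
by rewrite exprS sqrrN expr1n mulr1 !scaleN1r scale1r.
Qed.

Lemma sum_card1 (I : finType) (V : nmodType) (F : {set I} -> V) :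
  \sum_(X : {set I} | #|X| == 1%N) F X = \sum_i F [set i].
Proof.
rewrite -[RHS](@big_imset _ _ _ _ _ set1 predT) /=; last first.
  by move=> i j _ _; apply: set1_inj.
apply: eq_bigl => X; apply/cards1P/imsetP => [[i ->]|[i _ ->]]; by exists i.
Qed.

(** The empty set gives the term with [lambda], and the two singletons give the
terms in which [T] is applied to one argument. *)
Lemma Phi_multi2 (T : A -> A) (TM : {linear M -> M}) (f : A -> A -> M)
    (a b : A) :
  Phi lambda T TM (multi2 f) (ffun2 a b)
  = f (T a) (T b) - TM (f a (T b) + f (T a) b + lambda *: f a b).
Proof.
rewrite /Phi /= big_ord_recl big_ord1 (big_pred1 set0) => [|X]; last first.
  exact: cards_eq0.
rewrite sum_card1 big_ord_recl big_ord1.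
rewrite /multi2 !ffunE /= !(tnth_nth 0) /= !inE /=.
rewrite expr1 expr0 scale1r; congr (_ - _); rewrite !linearD linearZ /=.
by rewrite [RHS]addrC; congr (_ + _); apply: addrC.
Qed.

End LowDegree.

Section Defects.

Variables (k : fieldType) (lambda : k).
Variables (A : lmodType k) (mul : A -> A -> A) (T : A -> A).
Hypothesis rbA : is_rb_algebra lambda mul T.
Variables (M : lmodType k) (l : A -> M -> M) (r : M -> A -> M) (TM : M -> M).
Hypothesis rbM : is_rb_bimodule lambda mul T l r TM.
Variables (psi : {bilinear A -> A -> M}) (chi : {linear A -> M}).

(* Registered so that the generic linearity lemmas rewrite under [mul], [T],
   [l], [r] and [TM]. *)
HB.instance Definition _ :=
  bilinear_isBilinear.Build k A A A _ _ mul (rb_mul_bilinear rbA).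
HB.instance Definition _ := GRing.isLinear.Build k A A _ T (rb_linear rbA).
HB.instance Definition _ :=
  bilinear_isBilinear.Build k A M M _ _ l (rbm_l_bilinear rbM).
HB.instance Definition _ :=
  bilinear_isBilinear.Build k M A M _ _ r (rbm_r_bilinear rbM).
HB.instance Definition _ := GRing.isLinear.Build k M M _ TM (rbm_linear rbM).

Lemma ext_mul_bilinear : bilinear_for *:%R *:%R (ext_mul mul l r psi).
Proof.
split=> [y|x] c x1 x2; congr pair => /=.
- by rewrite linearPl.
- by rewrite !linearPl !scalerDr [LHS](AC (2*2*2) (1*3*5*(2*4*6)))/=.
- by rewrite linearPr.
- by rewrite !linearPr !scalerDr [LHS](AC (2*2*2) (1*3*5*(2*4*6)))/=.
Qed.

Lemma ext_op_linear : linear (ext_op T TM chi).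
Proof.
move=> c x y; congr pair => /=; first by rewrite linearP.
by rewrite !linearP scalerDr addrACA.
Qed.

(** The terms linear in [x.2], [y.2] and [z.2] cancel by the right, mixed and
left associativity of the actions, so the associator depends on the [A]
components alone. *)
Lemma ext_mul_associator (x y z : A * M) :
  ext_mul mul l r psi (ext_mul mul l r psi x y) z
    - ext_mul mul l r psi x (ext_mul mul l r psi y z)
  = (0, delta mul l r (multi2 psi) (ffun3 x.1 y.1 z.1)).
Proof.
case: x y z => [a m] [b n] [c p]; rewrite /delta hochschild_multi2.
congr pair => /=; first by rewrite (rb_mulA rbA) subrr.
rewrite !linearDl !linearDr /= (rbm_lA rbM) (rbm_lrA rbM) (rbm_rA rbM).
rewrite [X in _ - X](AC (3*1*1) (1*2*4*(3*5))) /=.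
rewrite [X in X - _](AC (1*3*1) (1*2*3*(4*5))) /=.
rewrite opprD [LHS]addrACA subrr add0r opprD.
by rewrite [LHS](AC (2*2) (3*(2*4)*1)).
Qed.

(** In [ext_op], the argument of [TM] splits into a part linear in [y.2], a part
linear in [x.2], and a part with [chi] and [psi]. The left and right
Rota-Baxter identities of [M] match the first two parts with
[l (T x.1) (TM y.2)] and [r (TM x.2) (T y.1)]. *)
Lemma ext_rb_defect (x y : A * M) :
  ext_mul mul l r psi (ext_op T TM chi x) (ext_op T TM chi y)
    - ext_op T TM chi
        (ext_mul mul l r psi x (ext_op T TM chi y)
         + ext_mul mul l r psi (ext_op T TM chi x) y
         + lambda *: ext_mul mul l r psi x y)
  = (0, partial lambda mul T l r TM (multi1 chi) (ffun2 x.1 y.1)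
        + Phi lambda T TM (multi2 psi) (ffun2 x.1 y.1)).
Proof.
case: x y => [a m] [b n]; rewrite /partial hochschild_multi1 Phi_multi2.
congr pair => /=; first by rewrite (rb_identity rbA) subrr.
rewrite /lstar /rstar -/(star lambda mul T a b).
(* Parts in [n], in [m], and in [chi] and [psi], in this order. *)
have -> : l a (chi b + TM n) + r m (T b) + psi a (T b)
      + (l (T a) n + r (chi a + TM m) b + psi (T a) b)
      + lambda *: (l a n + r m b + psi a b)
    = (l a (TM n) + l (T a) n + lambda *: l a n)
      + (r m (T b) + r (TM m) b + lambda *: r m b)
      + (l a (chi b) + r (chi a) b
         + (psi a (T b) + psi (T a) b + lambda *: psi a b)).
  rewrite linearDl linearDr /= !scalerDr.
  by rewrite [LHS](AC (4*(1*2*1)*3) (2*5*9*(3*7*10)*(1*6*(4*8*11)))).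
rewrite linearDl linearDr /= (rbm_l_identity rbM) (rbm_r_identity rbM).
have TMD u v : TM (u + v) = TM u + TM v by exact: linearD.
set u := l a (TM n) + _ + _; set w := r m (T b) + _ + _.
rewrite (TMD (u + w)) (TMD u) !(TMD (l a (chi b) + _)) (TMD (l a (chi b))).
rewrite [X in X - _](AC (2*2*1) (2*4*(1*3*5))) /=.
rewrite [X in _ - X](AC (1*(2*3)) (2*3*(1*4*5*6))) /=.
rewrite opprD [LHS]addrACA subrr add0r !opprD.
by rewrite [LHS](AC (3*4) (1*5*4*(2*6)*(3*7))).
Qed.

(** For the direct implication it is enough to look at elements [(a, 0)]: the
defects do not depend on the module components. *)
Lemma is_rb_algebra_extP :
  is_rb_algebra lambda (ext_mul mul l r psi) (ext_op T TM chi) <->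
  (forall a b c, delta mul l r (multi2 psi) (ffun3 a b c) = 0) /\
  (forall a b, partial lambda mul T l r TM (multi1 chi) (ffun2 a b)
               + Phi lambda T TM (multi2 psi) (ffun2 a b) = 0).
Proof.
split=> [rbE | [delta0 partial0]]; split.
- move=> a b c.
  have := ext_mul_associator (a, 0) (b, 0) (c, 0).
  by rewrite (rb_mulA rbE) subrr => -[].
- move=> a b; have := ext_rb_defect (a, 0) (b, 0).
  by rewrite (rb_identity rbE) subrr => -[].
- exact: ext_mul_bilinear.
- move=> x y z; apply/esym/eqP.
  by rewrite -subr_eq0 ext_mul_associator delta0.
- exact: ext_op_linear.
- by move=> x y; apply/eqP; rewrite -subr_eq0 ext_rb_defect partial0.
Qed.

Lemma is_rba_cocycle2P :
  is_rba_cocycle lambda mul T l r TM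
    ((multi2 psi, multi1 chi) : rba_cochain A M 2) <->
  (forall a b c, delta mul l r (multi2 psi) (ffun3 a b c) = 0) /\
  (forall a b, partial lambda mul T l r TM (multi1 chi) (ffun2 a b)
               + Phi lambda T TM (multi2 psi) (ffun2 a b) = 0).
Proof.
split=> [[_ [/= delta0 partial0]] | [delta0 partial0]].
  split=> [a b c | a b]; first exact: delta0.
  by apply: oppr_inj; rewrite oppr0 opprD.
split; split=> /=.
- exact: multilinear_multi2.
- exact: multilinear_multi1.
- by move=> v; rewrite (ffun3_eta v).
- by move=> v; rewrite (ffun2_eta v) -opprD partial0 oppr0.
Qed.

Lemma ext_incl_morphism :
  is_rb_morphism (@zero_mul k M) TM (ext_mul mul l r psi) (ext_op T TM chi)
    (@ext_incl k A M).
Proof.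
split=> [c m n | m n | m]; congr pair => /=.
- by rewrite scaler0 addr0.
- by rewrite linear0l.
- by rewrite linear0l linear0r linear0l !addr0.
- by rewrite linear0.
- by rewrite linear0 add0r.
Qed.

Lemma zero_mul_rb_algebra : is_rb_algebra lambda (@zero_mul k M) TM.
Proof.
split; rewrite /zero_mul //.
- by split=> m c x y; rewrite /= scaler0 addr0.
- exact: rbm_linear rbM.
- by move=> m n; rewrite scaler0 !addr0 linear0.
Qed.

Lemma ext_is_abelian_extension :
  is_rb_algebra lambda (ext_mul mul l r psi) (ext_op T TM chi) ->
  is_abelian_extension lambda mul T TM (ext_mul mul l r psi)
    (ext_op T TM chi) (@ext_incl k A M) (@ext_proj k A M).
Proof.
move=> rbE; split=> //.
- exact: zero_mul_rb_algebra.
- exact: ext_incl_morphism.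
- by move=> m n [].
- by case=> a m; split=> [/= -> | [n [<-]]] //; exists m.
- by move=> a; exists (a, 0).
Qed.

Lemma ext_section_induces :
  section_induces (ext_mul mul l r psi) (@ext_incl k A M) (@ext_section k A M)
    l r.
Proof.
split=> [a m | m a]; congr pair => /=.
- by rewrite linear0r.
- by rewrite linear0l linear0r !addr0.
- by rewrite linear0l.
- by rewrite linear0r linear0l add0r addr0.
Qed.

End Defects.

Lemma ext_section_is_section (k : fieldType) (A M : lmodType k) :
  is_section (@ext_proj k A M) (@ext_section k A M).
Proof. by split=> // c a b; congr pair; rewrite /= scaler0 addr0. Qed.

Theorem proposition7p7
  (k : fieldType) (char0 : [pchar k] =i pred0) (lambda : k)
  (A : lmodType k) (mul : A -> A -> A) (T : A -> A)
  (rbA : is_rb_algebra lambda mul T)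
  (M : lmodType k) (l : A -> M -> M) (r : M -> A -> M) (TM : M -> M)
  (rbM : is_rb_bimodule lambda mul T l r TM)
  (psi : {bilinear A -> A -> M}) (chi : {linear A -> M}) :
  (is_rb_algebra lambda (ext_mul mul l r psi) (ext_op T TM chi)
   <-> is_rba_cocycle lambda mul T l r TM
         ((multi2 psi, multi1 chi) : rba_cochain A M 2))
  /\
  (is_rb_algebra lambda (ext_mul mul l r psi) (ext_op T TM chi) ->
   [/\ is_abelian_extension lambda mul T TM
         (ext_mul mul l r psi) (ext_op T TM chi)
         (@ext_incl k A M) (@ext_proj k A M),
       is_section (@ext_proj k A M) (@ext_section k A M)
     & section_induces (ext_mul mul l r psi)
         (@ext_incl k A M) (@ext_section k A M) l r]).
Proof.
split.
  apply: iff_trans (is_rb_algebra_extP rbA rbM psi chi) _.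
  by apply: iff_sym; apply: is_rba_cocycle2P.
move=> rbE; split.
- exact: ext_is_abelian_extension.
- exact: ext_section_is_section.
- exact: (ext_section_induces rbA rbM).
Qed.
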